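(* Let $\mathbb{K}$ be a field, let $\mathcal{J}$ and $\mathcal{C}$ be small categories, and suppose that $\mathcal{C}$ has finite hom-sets. Let $F:\mathcal{J}\to\mathcal{C}$ be a functor. (a) $F$ is final if and only if $\operatorname{colim} MF\cong\operatorname{colim} M$ for all functors $M:\mathcal{C}\to\mathrm{vect}_{\mathbb{K}}$. (b) $F$ is initial if and only if $\lim MF\cong\lim M$ for all functors $M:\mathcal{C}\to\mathrm{vect}_{\mathbb{K}}$.
   Context: $\mathrm{Vect}_{\mathbb{K}}$ is the category of $\mathbb{K}$-vector spaces and $\mathrm{vect}_{\mathbb{K}}$ its full subcategory of finite-dimensional vector spaces; limits and colimits of functors into $\mathrm{vect}_{\mathbb{K}}$ are taken in $\mathrm{Vect}_{\mathbb{K}}$. $MF$ denotes the composite $M\circ F$. A category is connected if it is non-empty and any two objects are joined by a finite zigzag of morphisms. A functor $F:\mathcal{J}\to\mathcal{C}$ is final if for every object $c$ of $\mathcal{C}$ the comma category $c/F$ (objects: pairs $(j, c\to F(j))$) is non-empty and connected; it is initial if for every object $c$ the comma category $F/c$ (objects: pairs $(j,F(j)\to c)$) is non-empty and connected. *)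

(* Defs.v *)
From HB Require Import structures.
From mathcomp Require Import all_boot generic_quotient all_algebra.
From mathcomp Require Import boolp classical_sets functions cardinality.
From Stdlib Require Import Relation_Operators.

Set Implicit Arguments.
Unset Strict Implicit.
Unset Printing Implicit Defensive.

Import GRing.Theory.
Local Open Scope quotient_scope.
Local Open Scope ring_scope.

(* Small categories.  Smallness is relative to the universe of carriers of    *)
(* K-vector spaces: the constructions [lim] and [colim] below, which take      *)
(* products and sums over the objects, force [ob] into that universe.         *)
Record category := Category {
  ob :> Type;
  hom : ob -> ob -> Type;
  idm : forall a, hom a a;
  compm : forall a b c, hom b c -> hom a b -> hom a c;
  comp1m : forall a b (f : hom a b), compm (idm b) f = f;
  compm1 : forall a b (f : hom a b), compm f (idm a) = f;
  compmA : forall a b c d (h : hom c d) (g : hom b c) (f : hom a b),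
    compm h (compm g f) = compm (compm h g) f
}.
Arguments hom {c} _ _ : rename.
Arguments idm {c} a : rename.

Notation "g '\oc' f" := (compm g f) (at level 50, left associativity).

Record functor (J C : category) := Functor {
  fob :> J -> C;
  fmap : forall a b, hom a b -> hom (fob a) (fob b);
  fmap1 : forall a, fmap (idm a) = idm (fob a);
  fmapM : forall a b c (g : hom b c) (f : hom a b),
    fmap (g \oc f) = fmap g \oc fmap f
}.

Definition finite_homsets (C : category) : Prop :=
  forall a b : C, finite_set [set: hom a b].

Definition connected_cat (C : category) : Prop :=
  inhabited C /\
  forall a b : C, clos_refl_sym_trans C (fun x y => inhabited (hom x y)) a b.

Lemma sval_inj (T : Type) (P : T -> Prop) (x y : {t | P t}) :
  sval x = sval y -> x = y.
Proof.
case: x y => [x px] [y py] /= e; subst y.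
by rewrite (Prop_irrelevance px py).
Qed.

Section Comma.
Variables (J C : category) (F : functor J C) (c : C).

Definition under_ob := {j : J & hom c (F j)}.

Definition under_hom (x y : under_ob) :=
  {h : hom (projT1 x) (projT1 y) | fmap F h \oc projT2 x = projT2 y}.

Definition under_id (x : under_ob) : under_hom x x.
Proof. by exists (idm (projT1 x)); rewrite fmap1 comp1m. Defined.

Definition under_comp (x y z : under_ob)
  (g : under_hom y z) (f : under_hom x y) : under_hom x z.
Proof.
exists (proj1_sig g \oc proj1_sig f).
by rewrite fmapM -compmA (proj2_sig f) (proj2_sig g).
Defined.

(* The comma category c / F. *)
Definition under : category.
Proof.
apply: (@Category under_ob under_hom under_id under_comp).
- by move=> x y f; apply: sval_inj; apply: comp1m.
- by move=> x y f; apply: sval_inj; apply: compm1.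
- by move=> x y z t h g f; apply: sval_inj; apply: compmA.
Defined.

Definition over_ob := {j : J & hom (F j) c}.

Definition over_hom (x y : over_ob) :=
  {h : hom (projT1 x) (projT1 y) | projT2 y \oc fmap F h = projT2 x}.

Definition over_id (x : over_ob) : over_hom x x.
Proof. by exists (idm (projT1 x)); rewrite fmap1 compm1. Defined.

Definition over_comp (x y z : over_ob)
  (g : over_hom y z) (f : over_hom x y) : over_hom x z.
Proof.
exists (proj1_sig g \oc proj1_sig f).
by rewrite fmapM compmA (proj2_sig g) (proj2_sig f).
Defined.

(* The comma category F / c. *)
Definition over : category.
Proof.
apply: (@Category over_ob over_hom over_id over_comp).
- by move=> x y f; apply: sval_inj; apply: comp1m.
- by move=> x y f; apply: sval_inj; apply: compm1.
- by move=> x y z t h g f; apply: sval_inj; apply: compmA.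
Defined.

End Comma.

Definition final (J C : category) (F : functor J C) : Prop :=
  forall c : C, connected_cat (under F c).

Definition initial (J C : category) (F : functor J C) : Prop :=
  forall c : C, connected_cat (over F c).

(* A functor C -> vect_K: values are finite-dimensional, by [vectType]. *)
Record vect_functor (K : fieldType) (C : category) := VectFunctor {
  vob :> C -> vectType K;
  vmap : forall a b, hom a b -> {linear vob a -> vob b};
  vmap1 : forall a (x : vob a), vmap (idm a) x = x;
  vmapM : forall a b c (g : hom b c) (f : hom a b) (x : vob a),
    vmap (g \oc f) x = vmap g (vmap f x)
}.

Definition vcomp (K : fieldType) (J C : category)
  (M : vect_functor K C) (F : functor J C) : vect_functor K J.
Proof.
apply: (@VectFunctor K J (fun j => M (F j)) (fun a b f => vmap M (fmap F f))).
- by move=> a x; rewrite fmap1 vmap1.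
- by move=> a b c g f x; rewrite fmapM vmapM.
Defined.

(* The types [limit M] and [colimit M] are the universal properties; the      *)
(* chosen [lim M : limit M] and [colim M : colimit M] show that they are      *)
(* inhabited.  Apices are arbitrary K-vector spaces: limits and colimits are  *)
(* formed in Vect_K and not in vect_K.                                        *)
Section Limits.
Variables (K : fieldType) (C : category) (M : vect_functor K C).

Record cone (V : lmodType K) := Cone {
  proj :> forall c : C, {linear V -> M c};
  projP : forall a b (f : hom a b) (v : V), vmap M f (proj a v) = proj b v
}.

Record cocone (V : lmodType K) := Cocone {
  inj :> forall c : C, {linear M c -> V};
  injP : forall a b (f : hom a b) (x : M a), inj b (vmap M f x) = inj a x
}.

Record limit := Limit {
  lim_apex :> lmodType K;
  lim_cone : cone lim_apex;
  lim_univ : forall (V : lmodType K) (t : cone V),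
    exists u : {linear V -> lim_apex},
      (forall c v, lim_cone c (u v) = t c v) /\
      forall u' : {linear V -> lim_apex},
        (forall c v, lim_cone c (u' v) = t c v) -> u' =1 u
}.

Record colimit := Colimit {
  colim_apex :> lmodType K;
  colim_cocone : cocone colim_apex;
  colim_univ : forall (V : lmodType K) (t : cocone V),
    exists u : {linear colim_apex -> V},
      (forall c x, u (colim_cocone c x) = t c x) /\
      forall u' : {linear colim_apex -> V},
        (forall c x, u' (colim_cocone c x) = t c x) -> u' =1 u
}.

End Limits.

Section LimitConstruction.
Variables (K : fieldType) (C : category) (M : vect_functor K C).

Definition lim_type :=
  {x : forall c, M c | forall a b (f : hom a b), vmap M f (x a) = x b}.

HB.instance Definition _ := gen_eqMixin lim_type.
HB.instance Definition _ := gen_choiceMixin lim_type.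

Lemma lim_eq (x y : lim_type) : (forall c, sval x c = sval y c) -> x = y.
Proof. by move=> e; apply: sval_inj; apply: functional_extensionality_dep. Qed.

Definition lim_zero : lim_type.
Proof. by exists (fun c => 0) => a b f; rewrite linear0. Defined.

Definition lim_opp (x : lim_type) : lim_type.
Proof.
by exists (fun c => - sval x c) => a b f; rewrite linearN (proj2_sig x).
Defined.

Definition lim_add (x y : lim_type) : lim_type.
Proof.
exists (fun c => sval x c + sval y c) => a b f.
by rewrite linearD (proj2_sig x) (proj2_sig y).
Defined.

Definition lim_scale (k : K) (x : lim_type) : lim_type.
Proof.
by exists (fun c => k *: sval x c) => a b f; rewrite linearZ (proj2_sig x).
Defined.

Fact lim_addA : associative lim_add.
Proof. by move=> x y z; apply: lim_eq => c; apply: addrA. Qed.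
Fact lim_addC : commutative lim_add.
Proof. by move=> x y; apply: lim_eq => c; apply: addrC. Qed.
Fact lim_add0 : left_id lim_zero lim_add.
Proof. by move=> x; apply: lim_eq => c; apply: add0r. Qed.
Fact lim_addN : left_inverse lim_zero lim_opp lim_add.
Proof. by move=> x; apply: lim_eq => c; apply: addNr. Qed.

HB.instance Definition _ :=
  GRing.isZmodule.Build lim_type lim_addA lim_addC lim_add0 lim_addN.

Fact lim_scaleA k l (x : lim_type) :
  lim_scale k (lim_scale l x) = lim_scale (k * l) x.
Proof. by apply: lim_eq => c; apply: scalerA. Qed.
Fact lim_scale1 : left_id 1 lim_scale.
Proof. by move=> x; apply: lim_eq => c; apply: scale1r. Qed.
Fact lim_scaleDr : right_distributive lim_scale +%R.
Proof. by move=> k x y; apply: lim_eq => c; apply: scalerDr. Qed.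
Fact lim_scaleDl (x : lim_type) : {morph lim_scale^~ x : k l / k + l}.
Proof. by move=> k l; apply: lim_eq => c; apply: scalerDl. Qed.

HB.instance Definition _ := GRing.Zmodule_isLmodule.Build K lim_type
  lim_scaleA lim_scale1 lim_scaleDr lim_scaleDl.

Definition lim_proj c (x : lim_type) : M c := sval x c.

Fact lim_proj_linear c : linear (lim_proj c).
Proof. by []. Qed.

HB.instance Definition _ c :=
  GRing.isLinear.Build K lim_type (M c) _ (lim_proj c) (lim_proj_linear c).

Definition lim_lift (V : lmodType K) (t : cone M V) (v : V) : lim_type.
Proof. by exists (fun c => t c v) => a b f; apply: projP. Defined.

Fact lim_lift_linear V (t : cone M V) : linear (lim_lift t).
Proof. by move=> k v w; apply: lim_eq => c; apply: linearP. Qed.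

HB.instance Definition _ V (t : cone M V) :=
  GRing.isLinear.Build K V lim_type _ (lim_lift t) (lim_lift_linear t).

Definition lim : limit M.
Proof.
apply: (@Limit K C M lim_type
         (@Cone K C M lim_type lim_proj (fun a b f v => proj2_sig v a b f))).
move=> V t; exists (lim_lift t); split=> // u' hu' v.
by apply: lim_eq => c; apply: hu'.
Defined.

End LimitConstruction.

(* The colimit is the set of formal finite sums of elements of the M c,       *)
(* two of them being identified when every cocone gives them the same value.  *)
Section ColimitConstruction.
Variables (K : fieldType) (C : category) (M : vect_functor K C).

Definition formal_sum := seq {c : C & M c}.

HB.instance Definition _ := gen_eqMixin formal_sum.
HB.instance Definition _ := gen_choiceMixin formal_sum.

Definition fsum (V : lmodType K) (t : cocone M V) (s : formal_sum) : V :=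
  \sum_(p <- s) t (projT1 p) (projT2 p).

Definition fscale (k : K) (s : formal_sum) : formal_sum :=
  [seq existT (fun c => M c : Type) (projT1 p) (k *: projT2 p) | p <- s].

Lemma fsum_cat V (t : cocone M V) s1 s2 :
  fsum t (s1 ++ s2) = fsum t s1 + fsum t s2.
Proof. exact: big_cat. Qed.

Lemma fsum_scale V (t : cocone M V) k s : fsum t (fscale k s) = k *: fsum t s.
Proof.
rewrite /fsum /fscale big_map scaler_sumr.
by apply: eq_bigr => p _; rewrite linearZ.
Qed.

Definition fequiv (s1 s2 : formal_sum) : bool :=
  `[< forall (V : lmodType K) (t : cocone M V), fsum t s1 = fsum t s2 >].

Fact fequiv_refl : reflexive fequiv.
Proof. by move=> s; apply/asboolP. Qed.
Fact fequiv_sym : symmetric fequiv.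
Proof. by move=> s1 s2; apply/asboolP/asboolP => h V t; rewrite h. Qed.
Fact fequiv_trans : transitive fequiv.
Proof.
move=> s1 s2 s3 /asboolP h1 /asboolP h2; apply/asboolP => V t.
by rewrite h1 h2.
Qed.

Canonical fequiv_equiv := EquivRel fequiv fequiv_refl fequiv_sym fequiv_trans.

Definition colim_type := {eq_quot fequiv}.

HB.instance Definition _ := Choice.on colim_type.
HB.instance Definition _ := EqQuotient.on colim_type.

Definition cls (s : formal_sum) : colim_type := \pi_({eq_quot fequiv}) s.

Definition csum (V : lmodType K) (t : cocone M V) (x : colim_type) : V :=
  fsum t (repr x).

Lemma csum_cls V (t : cocone M V) s : csum t (cls s) = fsum t s.
Proof.
have /eqmodP/asboolP : (repr (cls s) = s %[mod {eq_quot fequiv}])%qT.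
  exact: reprK.
exact.
Qed.

Lemma colim_eq (x y : colim_type) :
  (forall (V : lmodType K) (t : cocone M V), csum t x = csum t y) -> x = y.
Proof.
move=> h; rewrite -[x]reprK -[y]reprK; apply/eqmodP/asboolP => V t.
exact: h.
Qed.

Definition colim_zero : colim_type := cls [::].
Definition colim_add (x y : colim_type) : colim_type := cls (repr x ++ repr y).
Definition colim_scale (k : K) (x : colim_type) : colim_type :=
  cls (fscale k (repr x)).
Definition colim_opp (x : colim_type) : colim_type := colim_scale (- 1) x.

Lemma csum_zero V (t : cocone M V) : csum t colim_zero = 0.
Proof. by rewrite csum_cls; apply: big_nil. Qed.
Lemma csum_add V (t : cocone M V) x y :
  csum t (colim_add x y) = csum t x + csum t y.
Proof. by rewrite csum_cls fsum_cat. Qed.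
Lemma csum_scale V (t : cocone M V) k x :
  csum t (colim_scale k x) = k *: csum t x.
Proof. by rewrite csum_cls fsum_scale. Qed.
Lemma csum_opp V (t : cocone M V) x : csum t (colim_opp x) = - csum t x.
Proof. by rewrite csum_scale scaleN1r. Qed.

Fact colim_addA : associative colim_add.
Proof. by move=> x y z; apply: colim_eq => V t; rewrite !csum_add addrA. Qed.
Fact colim_addC : commutative colim_add.
Proof. by move=> x y; apply: colim_eq => V t; rewrite !csum_add addrC. Qed.
Fact colim_add0 : left_id colim_zero colim_add.
Proof.
by move=> x; apply: colim_eq => V t; rewrite csum_add csum_zero add0r.
Qed.
Fact colim_addN : left_inverse colim_zero colim_opp colim_add.
Proof.
move=> x; apply: colim_eq => V t.
by rewrite csum_add csum_opp csum_zero addNr.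
Qed.

HB.instance Definition _ := GRing.isZmodule.Build colim_type
  colim_addA colim_addC colim_add0 colim_addN.

Fact colim_scaleA k l (x : colim_type) :
  colim_scale k (colim_scale l x) = colim_scale (k * l) x.
Proof. by apply: colim_eq => V t; rewrite !csum_scale scalerA. Qed.
Fact colim_scale1 : left_id 1 colim_scale.
Proof. by move=> x; apply: colim_eq => V t; rewrite csum_scale scale1r. Qed.
Fact colim_scaleDr : right_distributive colim_scale +%R.
Proof.
move=> k x y; apply: colim_eq => V t.
by rewrite csum_scale !csum_add scalerDr !csum_scale.
Qed.
Fact colim_scaleDl (x : colim_type) : {morph colim_scale^~ x : k l / k + l}.
Proof.
move=> k l; apply: colim_eq => V t.
by rewrite csum_add !csum_scale scalerDl.
Qed.

HB.instance Definition _ := GRing.Zmodule_isLmodule.Build K colim_type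
  colim_scaleA colim_scale1 colim_scaleDr colim_scaleDl.

Definition colim_inj c (x : M c) : colim_type :=
  cls [:: existT (fun c => M c : Type) c x].

Lemma csum_inj V (t : cocone M V) c (x : M c) : csum t (colim_inj x) = t c x.
Proof. by rewrite csum_cls /fsum big_seq1. Qed.

Fact colim_inj_linear c : linear (@colim_inj c).
Proof.
move=> k x y; apply: colim_eq => V t.
by rewrite csum_add csum_scale !csum_inj linearP.
Qed.

HB.instance Definition _ c := GRing.isLinear.Build K (M c) colim_type _
  (@colim_inj c) (@colim_inj_linear c).

Fact colim_injP a b (f : hom a b) (x : M a) :
  colim_inj (vmap M f x) = colim_inj x.
Proof. by apply: colim_eq => V t; rewrite !csum_inj injP. Qed.

Fact csum_linear V (t : cocone M V) : linear (csum t).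
Proof. by move=> k x y; rewrite csum_add csum_scale. Qed.

HB.instance Definition _ V (t : cocone M V) :=
  GRing.isLinear.Build K colim_type V _ (csum t) (csum_linear t).

Lemma colim_gen (x : colim_type) :
  x = \sum_(p <- repr x) colim_inj (projT2 p).
Proof.
apply: colim_eq => V t; rewrite linear_sum /= {1}/csum /fsum.
by apply: eq_bigr => p _; rewrite csum_inj.
Qed.

Definition colim : colimit M.
Proof.
apply: (@Colimit K C M colim_type
         (@Cocone K C M colim_type colim_inj colim_injP)).
move=> V t; exists (csum t); split=> [c x|u' hu' x]; first exact: csum_inj.
rewrite [x]colim_gen !linear_sum; apply: eq_bigr => p _ /=.
by rewrite csum_inj hu'.
Defined.

End ColimitConstruction.

(* Existence of some linear isomorphism; it is not required to be the         *)
(* canonical comparison map between two limits or two colimits.               *)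
Definition isomorphic (K : fieldType) (U V : lmodType K) : Prop :=
  exists f : {linear U -> V}, bijective f.

(* Main.v *)
(* If F is final, then a cocone on MF extends uniquely to M: precompose with   *)
(* M g for any g : c -> F j, the choice being irrelevant because c/F is        *)
(* connected.  Conversely, take M = K[hom(c,-)], which is finite-dimensional   *)
(* because hom-sets are finite.  By Yoneda colim M is the line spanned by the  *)
(* class of id_c, while colim MF = K[pi_0(c/F)]; an isomorphism, canonical or  *)
(* not, forces c/F to have exactly one component.  For limits, use             *)
(* M = K^hom(-,c) instead.                                                     *)
From HB Require Import structures.
From mathcomp Require Import all_boot all_algebra.
From mathcomp Require Import boolp classical_sets cardinality.
From Stdlib Require Import Relation_Operators.
Require Import Defs.

Set Implicit Arguments.
Unset Strict Implicit.
Unset Printing Implicit Defensive.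

Import GRing.Theory.
Local Open Scope ring_scope.

(** A cocone on MF must extend to x in M c by its value at M g x, for any g : c -> F j.
    Non-emptiness of c/F supplies g, and connectedness makes the value independent of it
    ([via_linked]), so the canonical map colim MF -> colim M is invertible ([final_colim]);
    [initial_lim] is dual.

    For the converses one functor per object c suffices: [free_hom] is K[hom(c,-)] and [fun_hom] is
    K^hom(-,c). By Yoneda its colimit, respectively limit, is a line. Each object of the comma
    category yields a vector and a linear form on the (co)limit of MF, and their pairings are 1 or 0
    according to whether the objects are joined by a zigzag. Any isomorphism with a line then leaves
    exactly one component ([connected_of_line]). *)

Definition linked (C : category) : C -> C -> Prop :=
  clos_refl_sym_trans C (fun x y => inhabited (hom x y)).

Lemma linked_invariant (C : category) (T : Type) (v : C -> T) :
  (forall x y, hom x y -> v x = v y) -> forall x y, linked x y -> v x = v y.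
Proof.
move=> hv x y; elim=> [a b [f]|//|a b _ //|a b c _ -> _ ->//].
exact: hv.
Qed.

Lemma linked_hom (C : category) (x y z : C) :
  hom x y -> `[< linked x z >] = `[< linked y z >].
Proof.
move=> f; apply/asboolP/asboolP => h.
  by apply: rst_trans h; apply/rst_sym/rst_step.
by apply: rst_trans h; apply: rst_step.
Qed.

Lemma eq_colim_linear (K : fieldType) (C : category) (M : vect_functor K C)
  (V : lmodType K) (f g : {linear colim_type M -> V}) :
  (forall c (x : M c), f (colim_inj x) = g (colim_inj x)) -> f =1 g.
Proof.
move=> fg x; rewrite [x]colim_gen !linear_sum /=.
by apply: eq_bigr => p _; apply: fg.
Qed.

(** * Final functors preserve colimits *)

Section Final.
Variables (K : fieldType) (J C : category) (F : functor J C).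
Variable M : vect_functor K C.

Definition colim_restr_cocone : cocone (vcomp M F) (colim_type M).
Proof.
pose t j : {linear vcomp M F j -> colim_type M} :=
  (@colim_inj K C M (F j) : {linear M (F j) -> colim_type M}).
by exists t => a b f x; apply: (@colim_injP K C M).
Defined.

Definition via (c : C) (x : M c) (p : under F c) : colim_type (vcomp M F) :=
  @colim_inj K J (vcomp M F) (projT1 p) (vmap M (projT2 p) x).

(** A morphism h from p to q factors the arrow of q through F h, and the colimit cocone of MF
    absorbs M (F h). *)
Lemma via_linked c x (p q : under F c) : linked p q -> via x p = via x q.
Proof.
apply: linked_invariant => {p q} p q [h /= e].
rewrite /via -e vmapM.
by rewrite (@colim_injP _ _ (vcomp M F) _ _ h (vmap M (projT2 p) x)).
Qed.

Hypothesis finF : final F.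

Definition under_pick c : under F c := proj1_sig (cid
  (let: conj (inhabits p) _ := finF c in ex_intro (fun _ => True) p I)).

Lemma via_pick c x (p : under F c) : via x (under_pick c) = via x p.
Proof. by apply: via_linked; apply: (finF c).2. Qed.

Definition colim_ext c (x : M c) := via x (under_pick c).

Fact colim_ext_linear c : linear (@colim_ext c).
Proof. by move=> k x y; rewrite /colim_ext /via !linearP. Qed.

HB.instance Definition _ c := GRing.isLinear.Build K (M c)
  (colim_type (vcomp M F)) _ (@colim_ext c) (@colim_ext_linear c).

Definition colim_ext_cocone : cocone M (colim_type (vcomp M F)).
Proof.
apply: (@Cocone _ _ M (colim_type (vcomp M F)) colim_ext) => a b f x.
(* The picked arrow b -> F j, precomposed with f, is an object of a/F, and the value at a may be
   computed through it. *)
pose p := under_pick b.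
rewrite /= [RHS](@via_pick _ _
  (existT (fun j => hom a (F j)) (projT1 p) (projT2 p \oc f))).
by rewrite /via /= vmapM.
Defined.

Lemma final_colim : isomorphic (colim (vcomp M F)) (colim M).
Proof.
exists (csum colim_restr_cocone).
exists (csum colim_ext_cocone).
  apply: (@eq_colim_linear _ _ _ _
    (csum colim_ext_cocone \o csum colim_restr_cocone) idfun) => j x /=.
  rewrite (csum_inj colim_restr_cocone) (csum_inj colim_ext_cocone) /=.
  rewrite /colim_ext.
  (* The choice made for F j may be replaced by the identity of F j, an object of F j / F. *)
  rewrite (@via_pick _ _ (existT (fun j => hom _ (F j)) _ (idm _))).
  by rewrite /via /= vmap1.
apply: (@eq_colim_linear _ _ _ _
  (csum colim_restr_cocone \o csum colim_ext_cocone) idfun) => c x /=.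
rewrite (csum_inj colim_ext_cocone) (csum_inj colim_restr_cocone) /=.
exact: colim_injP.
Qed.

End Final.

(** * Initial functors preserve limits *)

Section Initial.
Variables (K : fieldType) (J C : category) (F : functor J C).
Variable M : vect_functor K C.

Definition lim_restr_cone : cone (vcomp M F) (lim_type M).
Proof.
pose t j : {linear lim_type M -> vcomp M F j} :=
  (@lim_proj K C M (F j) : {linear lim_type M -> M (F j)}).
by exists t => a b f x; apply: (proj2_sig x).
Defined.

Definition via_over (c : C) (y : lim_type (vcomp M F)) (p : over F c) : M c :=
  vmap M (projT2 p) (sval y (projT1 p)).

(** For h from p to q, the component of y at q is the image under M (F h) of its component at p, and
    the arrow of q after F h is the arrow of p. *)
Lemma via_over_linked c y (p q : over F c) :
  linked p q -> via_over y p = via_over y q.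
Proof.
apply: linked_invariant => {p q} p q [h /= e].
by rewrite /via_over -e vmapM; congr (vmap M _ _); apply: (proj2_sig y _ _ h).
Qed.

Hypothesis iniF : initial F.

Definition over_pick c : over F c := proj1_sig (cid
  (let: conj (inhabits p) _ := iniF c in ex_intro (fun _ => True) p I)).

Lemma via_over_pick c y (p : over F c) :
  via_over y (over_pick c) = via_over y p.
Proof. by apply: via_over_linked; apply: (iniF c).2. Qed.

Definition lim_ext c (y : lim_type (vcomp M F)) : M c :=
  via_over y (over_pick c).

Fact lim_ext_linear c : linear (@lim_ext c).
Proof. by move=> k x y; rewrite /lim_ext /via_over linearP. Qed.

HB.instance Definition _ c := GRing.isLinear.Build K (lim_type (vcomp M F))
  (M c) _ (@lim_ext c) (@lim_ext_linear c).

Definition lim_ext_cone : cone M (lim_type (vcomp M F)).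
Proof.
apply: (@Cone _ _ M (lim_type (vcomp M F)) lim_ext) => a b f y.
pose p := over_pick a.
rewrite /= [RHS](@via_over_pick _ _
  (existT (fun j => hom (F j) b) (projT1 p) (f \oc projT2 p))).
by rewrite /via_over /= vmapM.
Defined.

Lemma initial_lim : isomorphic (lim (vcomp M F)) (lim M).
Proof.
exists (lim_lift lim_ext_cone).
exists (lim_lift lim_restr_cone) => y; apply: lim_eq => c /=.
  rewrite /lim_proj /= /lim_ext.
  rewrite (@via_over_pick _ _ (existT (fun j => hom (F j) _) c (idm _))).
  by rewrite /via_over /= vmap1.
by rewrite /lim_ext /via_over /=; apply: (proj2_sig y).
Qed.

End Initial.

(* An alias of [hom], the key under which its [finType] structure is declared. *)
Definition fhom (C : category) (hC : finite_homsets C) (a b : C) := hom a b.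

(** * Finite hom-sets as finite types *)

Section FiniteHom.
Variables (C : category) (hC : finite_homsets C) (a b : C).

HB.instance Definition _ := gen_eqMixin (fhom hC a b).
HB.instance Definition _ := gen_choiceMixin (fhom hC a b).

Lemma fhom_enum : {s : seq (fhom hC a b) | Finite.axiom (undup s)}.
Proof.
apply: cid; have /finite_seqP [s hs] : finite_set [set: fhom hC a b].
  exact: hC.
exists s => x; rewrite count_uniq_mem ?undup_uniq // mem_undup.
by have : [set: fhom hC a b]%classic x by []; rewrite hs /= => ->.
Qed.

Fact fhom_pickleK : pcancel (index^~ (undup (sval fhom_enum)))
  (nth None [seq Some x | x <- undup (sval fhom_enum)]).
Proof.
move=> x; have x_in : x \in undup (sval fhom_enum).
  by rewrite -has_pred1 has_count (proj2_sig fhom_enum).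
by rewrite (nth_map x) ?index_mem // nth_index.
Qed.

HB.instance Definition _ := isCountable.Build (fhom hC a b) fhom_pickleK.
HB.instance Definition _ := isFinite.Build (fhom hC a b) (proj2_sig fhom_enum).

End FiniteHom.

(** On a line the images of [d p] and [d q] are proportional. If p and q were not linked, applying
    [s p] to this relation would kill [d q], against [s q (d q) = 1]. Non-emptiness holds because V,
    being isomorphic to a nonzero space, is not zero. *)
Lemma connected_of_line (K : fieldType) (D : category) (V W : lmodType K)
    (e : W) (d : D -> V) (s : D -> {linear V -> K^o}) :
  isomorphic V W -> e <> 0 -> (forall w : W, exists k, w = k *: e) ->
  ((D -> False) -> forall v : V, v = 0) ->
  (forall p q, s p (d q) = `[< linked q p >]%:R) -> connected_cat D.
Proof.
move=> [phi [psi phiK psiK]] e_neq0 span empty sd; split.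
  have [//|noD] := pselect (inhabited D); case: e_neq0.
  have no_ob : D -> False by move=> p; apply: noD.
  by rewrite -[e]psiK (empty no_ob (psi e)) linear0.
move=> p q; apply: contrapT => npq.
have sqq x : s x (d x) = 1.
  by rewrite sd; case: asboolP => // -[]; apply: rst_refl.
have spq : s p (d q) = 0.
  by rewrite sd; case: asboolP => // /(@rst_sym D _ _ _)/npq.
have [kp ep] := span (phi (d p)); have [kq eq] := span (phi (d q)).
(* Both sides are sent by [phi] to the multiple of [e] by the product of [kp] and [kq]. *)
have dep : kp *: d q = kq *: d p.
  by apply: (can_inj phiK); rewrite !linearZ /= ep eq !scalerA mulrC.
have kq0 : kq = 0.
  have /esym := congr1 (s p) dep.
  by rewrite !linearZ /= sqq spq scaler0 /GRing.scale /= mulr1.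
have dq0 : d q = 0 by apply: (can_inj phiK); rewrite eq kq0 scale0r linear0.
by have /eqP := sqq q; rewrite dq0 linear0 eq_sym oner_eq0.
Qed.

(** * The functor K[hom(c,-)] and finality *)

Section Corepresentable.
Variables (K : fieldType) (C : category) (hC : finite_homsets C) (c : C).

Notation H := (fhom hC c).

(** Functions on the finite set hom(c,a) stand for formal combinations of its elements, so
    postcomposition by f acts by summing over fibres. *)
Definition push a b (f : hom a b) (u : {ffun H a -> K^o}) : {ffun H b -> K^o} :=
  [ffun h => \sum_(g : H a | (f \oc g : H b) == h) u g].

Fact push_linear a b (f : hom a b) : linear (push f).
Proof.
move=> k u v; apply/ffunP => h; rewrite !ffunE scaler_sumr -big_split /=.
by apply: eq_bigr => g _; rewrite !ffunE.
Qed.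

HB.instance Definition _ a b (f : hom a b) :=
  GRing.isLinear.Build K {ffun H a -> K^o} {ffun H b -> K^o} _
    (push f) (push_linear f).

(** Change of variables for the pushforward; it turns weights invariant under postcomposition into
    cocones. *)
Lemma push_weight a b (f : hom a b) (w : H b -> K) (u : {ffun H a -> K^o}) :
  \sum_(h : H b) w h * push f u h =
  \sum_(g : H a) w (f \oc g : H b) * u g.
Proof.
rewrite (partition_big (fun g : H a => f \oc g : H b) xpredT) //=.
apply: eq_bigr => h _; rewrite ffunE mulr_sumr.
by apply: eq_bigr => g /eqP ->.
Qed.

Definition free_hom : vect_functor K C.
Proof.
apply: (@VectFunctor K C (fun a => {ffun H a -> K^o} : vectType K)
  (fun a b f => push f : {linear {ffun H a -> K^o} -> {ffun H b -> K^o}})).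
- move=> a u; apply/ffunP => h; rewrite ffunE.
  by rewrite (eq_bigl (pred1 h)) ?big_pred1_eq // => g; rewrite comp1m.
- move=> a b d g f u; apply/ffunP => h; rewrite !ffunE.
  rewrite (partition_big (fun k : H a => f \oc k : H b)
    (fun l => (g \oc l : H d) == h)) /=; last by move=> k; rewrite compmA.
  apply: eq_bigr => l /eqP lh; rewrite ffunE; apply: eq_bigl => k.
  have [kl|_] := eqVneq (f \oc k : H b) l; last by rewrite andbF.
  by rewrite andbT -compmA kl lh eqxx.
Defined.

Definition unit_hom a (g : H a) : free_hom a :=
  [ffun h : H a => (h == g)%:R : K^o].

Lemma push_unit a b (f : hom a b) (g : H a) :
  vmap free_hom f (unit_hom g) = unit_hom (f \oc g : H b).
Proof.
apply/ffunP => h; rewrite !ffunE.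
have [->|hfg] := eqVneq h (f \oc g : H b).
  rewrite (bigD1 g) //= ffunE eqxx big1 ?addr0 // => k /andP[_ /negPf kg].
  by rewrite ffunE kg.
rewrite big1 // => k /eqP fk; rewrite ffunE.
by have [kg|//] := eqVneq k g; move: hfg; rewrite -fk kg eqxx.
Qed.

Lemma unit_hom_gen a (u : free_hom a) :
  u = \sum_(g : H a) (u : {ffun H a -> K^o}) g *: unit_hom g.
Proof.
apply/ffunP => h; rewrite sum_ffunE (bigD1 h) //= !ffunE eqxx.
rewrite big1 ?addr0 => [|g /negPf gh]; first by rewrite /GRing.scale /= mulr1.
by rewrite !ffunE eq_sym gh scaler0.
Qed.

Definition free_hom_generator : colim_type free_hom :=
  colim_inj (unit_hom (idm c : H c)).

(** Yoneda: the basis vector g is the image of the basis vector of the identity under the action of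
    g. *)
Lemma inj_unit_hom a (g : H a) : colim_inj (unit_hom g) = free_hom_generator.
Proof.
rewrite /free_hom_generator.
rewrite -(@colim_injP _ _ free_hom _ _ g (unit_hom (idm c : H c))) push_unit.
by rewrite compm1.
Qed.

Lemma free_hom_line (x : colim_type free_hom) :
  exists k, x = k *: free_hom_generator.
Proof.
(* Every basis vector becomes the generator, so the coefficient is the total of all coordinates. *)
exists (\sum_(p <- repr x) \sum_(g : H (projT1 p))
  (projT2 p : {ffun H (projT1 p) -> K^o}) g).
rewrite {1}[x]colim_gen scaler_suml; apply: eq_bigr => p _.
rewrite [projT2 p in LHS]unit_hom_gen linear_sum scaler_suml.
by apply: eq_bigr => g _; rewrite linearZ /= inj_unit_hom.
Qed.

Definition weight a (w : H a -> K) (u : {ffun H a -> K^o}) : K^o :=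
  \sum_(g : H a) w g * u g.

Fact weight_linear a (w : H a -> K) : linear (weight w).
Proof.
move=> k u v; rewrite /weight scaler_sumr -big_split /=.
apply: eq_bigr => g _; rewrite !ffunE /GRing.scale /=.
by rewrite mulrDr mulrCA.
Qed.

HB.instance Definition _ a (w : H a -> K) :=
  GRing.isLinear.Build K {ffun H a -> K^o} K^o _ (weight w) (weight_linear w).

Lemma weight_unit_hom a (w : H a -> K) (g : H a) : weight w (unit_hom g) = w g.
Proof.
rewrite /weight (bigD1 g) //= ffunE eqxx mulr1 big1 ?addr0 // => k /negPf kg.
by rewrite ffunE kg mulr0.
Qed.

(** The sum of coordinates is a cocone, and it takes the value 1 on the generator. *)
Lemma free_hom_generator_neq0 : free_hom_generator <> 0.
Proof.
pose t a : {linear free_hom a -> K^o} := weight (fun=> 1).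
have tP a b (f : hom a b) (u : free_hom a) : t b (vmap free_hom f u) = t a u.
  exact: push_weight.
move=> /(congr1 (csum (Cocone tP))) /eqP.
by rewrite linear0 csum_inj /= weight_unit_hom oner_eq0.
Qed.

Section Comparison.
Variables (J : category) (F : functor J C).

(** Functions constant on the components of c/F are linear forms on colim MF, which is
    K[pi_0(c/F)]. *)
Definition under_weight_cocone (w : under F c -> K)
  (w_hom : forall p q, hom p q -> w p = w q) : cocone (vcomp free_hom F) K^o.
Proof.
exists (fun j => weight (fun g => w (existT (fun j => hom c (F j)) j g))
  : {linear {ffun H (F j) -> K^o} -> K^o}).
move=> a b f u; rewrite /= [LHS]push_weight; apply: eq_bigr => g _.
congr (_ * _); symmetry; apply: w_hom.
by exists f.
Defined.

Lemma final_of_colim_free_hom :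
  isomorphic (colim_type (vcomp free_hom F)) (colim_type free_hom) ->
  connected_cat (under F c).
Proof.
move=> iso.
pose w (p q : under F c) : K := `[< linked q p >]%:R.
have wP p x y : hom x y -> w p x = w p y.
  by move=> f; rewrite /w (linked_hom p f).
apply: (@connected_of_line _ _ _ _ free_hom_generator
  (fun p : under F c => @colim_inj K J (vcomp free_hom F) (projT1 p)
     (unit_hom (projT2 p : H (F (projT1 p)))))
  (fun p => csum (under_weight_cocone (wP p)))
  iso free_hom_generator_neq0 free_hom_line) => [empty x|p q].
  rewrite [x]colim_gen big1 // => -[j u] _ /=.
  (* If c/F is empty, so is each hom(c, F j), and functions on it are all zero. *)
  suff -> : u = 0 by apply: linear0.
  by apply/ffunP => g; case: empty; exists j.
rewrite /= (csum_inj (under_weight_cocone (wP p))) /= weight_unit_hom /w.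
by case: q.
Qed.

End Comparison.

End Corepresentable.

(** * The functor K^hom(-,c) and initiality *)

Section Representable.
Variables (K : fieldType) (C : category) (hC : finite_homsets C) (c : C).

Notation H a := (fhom hC a c).

Definition pull a b (f : hom a b) (u : {ffun H a -> K^o}) : {ffun H b -> K^o} :=
  [ffun h : H b => u (h \oc f : H a)].

Fact pull_linear a b (f : hom a b) : linear (pull f).
Proof. by move=> k u v; apply/ffunP => h; rewrite !ffunE. Qed.

HB.instance Definition _ a b (f : hom a b) :=
  GRing.isLinear.Build K {ffun H a -> K^o} {ffun H b -> K^o} _
    (pull f) (pull_linear f).

Definition fun_hom : vect_functor K C.
Proof.
apply: (@VectFunctor K C (fun a => {ffun H a -> K^o} : vectType K)
  (fun a b f => pull f : {linear {ffun H a -> K^o} -> {ffun H b -> K^o}})).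
- by move=> a u; apply/ffunP => h; rewrite ffunE compm1.
- by move=> a b d g f u; apply/ffunP => h; rewrite !ffunE compmA.
Defined.

Definition fun_hom_one : lim_type fun_hom.
Proof.
exists (fun a => [ffun=> 1] : {ffun H a -> K^o}) => a b f.
by apply/ffunP => h; rewrite !ffunE.
Defined.

Lemma fun_hom_one_neq0 : fun_hom_one <> 0.
Proof.
move=> /(congr1 (fun x => (sval x c : {ffun H c -> K^o}) (idm c))) /eqP.
by rewrite !ffunE oner_eq0.
Qed.

(** Compatibility along g : a -> c, read at the identity of c, forces the value of x at g to be its
    value at that identity. *)
Lemma fun_hom_line (x : lim_type fun_hom) : exists k, x = k *: fun_hom_one.
Proof.
exists ((sval x c : {ffun H c -> K^o}) (idm c)).
apply: lim_eq => a; apply/ffunP => g; rewrite !ffunE.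
rewrite -(proj2_sig x a c g) ffunE comp1m /GRing.scale /=.
by rewrite mulr1.
Qed.

Section Comparison.
Variables (J : category) (F : functor J C).

Definition over_eval (p : over F c) (x : lim_type (vcomp fun_hom F)) : K^o :=
  (sval x (projT1 p) : {ffun H (F (projT1 p)) -> K^o}) (projT2 p).

Fact over_eval_linear p : linear (over_eval p).
Proof. by move=> k x y; rewrite /over_eval !ffunE. Qed.

HB.instance Definition _ p := GRing.isLinear.Build K
  (lim_type (vcomp fun_hom F)) K^o _ (over_eval p) (over_eval_linear p).

(** The indicator of the component of p in F/c; it is compatible because f is a morphism in F/c from
    h composed with F f to h. *)
Definition over_indicator (p : over F c) : lim_type (vcomp fun_hom F).
Proof.
exists (fun j => [ffun g : H (F j) =>
  `[< linked (existT (fun j => hom (F j) c) j g : over F c) p >]%:R]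
  : {ffun H (F j) -> K^o}).
move=> a b f; apply/ffunP => h; rewrite !ffunE; congr (nat_of_bool _)%:R.
by apply: linked_hom; exists f.
Defined.

Lemma initial_of_lim_fun_hom :
  isomorphic (lim_type (vcomp fun_hom F)) (lim_type fun_hom) ->
  connected_cat (over F c).
Proof.
move=> iso.
apply: (@connected_of_line _ _ _ _ fun_hom_one over_indicator
  (fun p => over_eval p) iso fun_hom_one_neq0 fun_hom_line) => [empty x|p q].
  by apply: lim_eq => j; apply/ffunP => g; case: empty; exists j.
rewrite /= /over_eval ffunE; congr (nat_of_bool _)%:R.
by case: p => j g; apply: asbool_equiv_eq; split; apply: rst_sym.
Qed.

End Comparison.

End Representable.

Theorem theorem2 (K : fieldType) (J C : category) (hC : finite_homsets C)
    (F : functor J C) :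
  (final F <->
     forall M : vect_functor K C, isomorphic (colim (vcomp M F)) (colim M)) /\
  (initial F <->
     forall M : vect_functor K C, isomorphic (lim (vcomp M F)) (lim M)).
Proof.
split; split=> [h M|h c].
- exact: final_colim.
- exact/(@final_of_colim_free_hom K C hC)/h.
- exact: initial_lim.
- exact/(@initial_of_lim_fun_hom K C hC)/h.
Qed.
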